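(* The expected weight of the solution output by the mechanism CATE is at least $1-1/e$ times the weight of the optimal solution of IP(1).
   Context: Setting. $\mathcal S=\{s_1,\dots,s_m\}$ is a finite set of channels, each available during $[0,T]$. $\mathcal R'$ is a finite set of $n$ requests; request $r_i$ asks for one channel during a fixed time interval of length $t_i>0$ contained in $[0,T]$ and has weight $\phi_i(b_i)\ge 0$ (its bid, or its virtual bid). Data: $c_{i,j}\in\{0,1\}$ ($=1$ iff the location of $r_i$ lies in the license area of $s_j$), and $y_{i,k,j}=y_{k,i,j}\in\{0,1\}$ ($=1$ iff $r_i,r_k$ conflict in channel $s_j$; conflicting requests have overlapping time intervals). The endpoints of all requested intervals cut $[0,T]$ into at most $2n+1$ time slices; $t_j^l$ is the length of the $l$-th slice of channel $s_j$; $a_i$ and $d_i$ denote the indices of the first and last slices in the interval of $r_i$, so $\sum_{l=a_i}^{d_i}t_j^l=t_i$. IP(1): maximize $\sum_{s_j\in\mathcal S}\sum_{r_i\in\mathcal R'}\phi_i(b_i)x_{i,j}$ subject to, for all $r_i\in\mathcal R'$, $s_j\in\mathcal S$ and all slices $l$: $\sum_{s_j\in\mathcal S}x_{i,j}\le 1$; $x_{j,i}^l\le c_{i,j}$; $\sum_{k\ne i}x_{j,k}^l y_{i,k,j}+x_{j,i}^l\le 1$; $\sum_{l=a_i}^{d_i}x_{j,i}^l t_j^l=t_i x_{i,j}$; $x_{i,j}\in\{0,1\}$; $x_{j,i}^l\in\{0,1\}$. LP(2) is the relaxation of IP(1) in which the last two conditions are replaced by $0\le x_{i,j}\le 1$ and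 $0\le x_{j,i}^l\le 1$. Write $x_i=\sum_{s_j\in\mathcal S}x_{i,j}$; the weight of a solution is its objective value. Mechanism CATE (allocation part). Let $\alpha=\frac{e}{e-1}$. Compute an optimal solution $(x_i)$ of LP(2). Take a set $\mathcal L$ of feasible solutions of IP(1) (with $x_i^l\in\{0,1\}$ indicating whether $r_i$ wins in $l\in\mathcal L$) and a probability distribution $q$ on $\mathcal L$ with $\sum_{l\in\mathcal L}x_i^l q(l)=x_i/\alpha$ for every $r_i\in\mathcal R'$; output $l\in\mathcal L$ with probability $q(l)$. *)

(* Defs.v *)
From HB Require Import structures.
From mathcomp Require Import all_boot all_order all_algebra finmap.
From mathcomp Require Import reals sequences exp.

Set Implicit Arguments.
Unset Strict Implicit.
Unset Printing Implicit Defensive.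

Import Order.TTheory GRing.Theory Num.Theory.
Local Open Scope ring_scope.

(* All m channels are available during [0, horizon]. [weight_fun i] is the
   function phi_i (the identity, or a virtual bid function). Intervals that
   merely touch are allowed to count as overlapping. *)
Record auction (R : realType) (m n : nat) := Auction {
  horizon : R;
  start : 'I_n -> R;
  finish : 'I_n -> R;
  bid : 'I_n -> R;
  weight_fun : 'I_n -> R -> R;
  covers : 'I_n -> 'I_m -> bool;               (* c_{i,j} *)
  conflict : 'I_n -> 'I_n -> 'I_m -> bool;     (* y_{i,k,j} *)
  horizon_gt0 : 0 < horizon;
  start_ge0 : forall i, 0 <= start i;
  start_lt_finish : forall i, start i < finish i;
  finish_le_horizon : forall i, finish i <= horizon;
  weight_fun_ge0 : forall i, 0 <= weight_fun i (bid i);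
  conflict_sym : forall i k j, conflict i k j = conflict k i j;
  conflict_overlap : forall i k j, conflict i k j ->
    (start i <= finish k) && (start k <= finish i)
}.

Section Programs.
Context {R : realType} {m n : nat} (A : auction R m n).

Definition duration (i : 'I_n) : R := finish A i - start A i.

Definition request_weight (i : 'I_n) : R := weight_fun A i (bid A i).

Definition cut_points : seq R :=
  sort <=%R (undup (0 :: horizon A :: [seq start A i | i : 'I_n]
                                   ++ [seq finish A i | i : 'I_n])).

Definition nb_slices : nat := (size cut_points).-1.

(* Slice l is the interval between cut points l and l.+1. Every channel is
   available during the whole of [0, horizon], so all channels have the same
   slices and t_j^l does not depend on j. *)
Definition slice_len (l : 'I_nb_slices) : R := cut_points`_l.+1 - cut_points`_l.

Definition first_slice (i : 'I_n) : nat := index (start A i) cut_points.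
Definition last_slice (i : 'I_n) : nat := (index (finish A i) cut_points).-1.

Lemma nb_slices_le : (nb_slices <= n.*2.+1)%N.
Proof.
rewrite /nb_slices size_sort; apply: leq_trans (_ : (n.*2.+2.-1 <= _)%N) => //.
rewrite -!subn1 leq_sub2r// (leq_trans (size_undup _))//=.
by rewrite size_cat !size_image card_ord addnn.
Qed.

Lemma sum_slice_len (i : 'I_n) :
  \sum_(l < nb_slices | (first_slice i <= l <= last_slice i)%N) slice_len l
  = duration i.
Proof.
have sI : start A i \in cut_points.
  rewrite mem_sort mem_undup !inE mem_cat.
  by rewrite (map_f (start A)) ?mem_enum// !orbT.
have fI : finish A i \in cut_points.
  rewrite mem_sort mem_undup !inE mem_cat.
  by rewrite (map_f (finish A)) ?mem_enum// !orbT.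
have srt : sorted <=%R cut_points by exact: sort_le_sorted.
have ltsf : (index (start A i) cut_points < index (finish A i) cut_points)%N.
  rewrite ltnNge; apply/negP => le_fs.
  have := sorted_leq_nth le_trans le_refl 0 srt.
  move=> /(_ (index (finish A i) cut_points) (index (start A i) cut_points)).
  rewrite !inE !index_mem => /(_ fI sI le_fs).
  by rewrite !nth_index// leNgt start_lt_finish.
have f_gt0 : (0 < index (finish A i) cut_points)%N by apply: leq_trans ltsf.
have f_le : (index (finish A i) cut_points <= nb_slices)%N.
  by rewrite -ltnS /nb_slices prednK ?index_mem//; case: cut_points fI.
pose F k := cut_points`_k.+1 - cut_points`_k.
pose P k := (first_slice i <= k <= last_slice i)%N.
transitivity (\sum_(0 <= l < nb_slices | P l) F l); first by rewrite big_mkord.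
rewrite (big_cat_nat (leq0n _) f_le)/= addrC big_nat_cond big1 ?add0r; last first.
  move=> k; rewrite /P /last_slice => /andP[/andP[fk _] /andP[_]].
  by rewrite leqNgt prednK// fk.
rewrite (big_cat_nat (leq0n _) (ltnW ltsf))/= big_nat_cond big1 ?add0r; last first.
  by move=> k; rewrite /P /first_slice => /andP[/andP[_ ks] /andP[]]; rewrite leqNgt ks.
rewrite big_nat_cond (eq_bigl (fun k => (index (start A i) cut_points <= k
    < index (finish A i) cut_points)%N && true)); last first.
  move=> k; rewrite /P /first_slice /last_slice andbT.
  by rewrite -[(k <= _.-1)%N]ltnS prednK// andbb.
by rewrite -big_nat_cond telescope_sumr ?(ltnW ltsf)// !nth_index.
Qed.

(* An assignment of values to the variables x_{i,j} and x_{j,i}^l. *)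
Definition solution : Type :=
  ({ffun 'I_n * 'I_m -> R} * {ffun 'I_m * 'I_n * 'I_nb_slices -> R})%type.

HB.instance Definition _ := Choice.on solution.

Definition xreq (s : solution) (i : 'I_n) (j : 'I_m) : R := s.1 (i, j).
Definition xslice (s : solution) (j : 'I_m) (i : 'I_n) (l : 'I_nb_slices) : R :=
  s.2 (j, i, l).

Definition xtot (s : solution) (i : 'I_n) : R := \sum_(j < m) xreq s i j.

Definition weight (s : solution) : R :=
  \sum_(j < m) \sum_(i < n) request_weight i * xreq s i j.

Definition common_constraints (s : solution) : Prop :=
  [/\ forall i, \sum_(j < m) xreq s i j <= 1,
      forall i j l, xslice s j i l <= (covers A i j)%:R,
      forall i j l,
        \sum_(k < n | k != i) xslice s j k l * (conflict A i k j)%:R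
          + xslice s j i l <= 1 &
      forall i j,
        \sum_(l < nb_slices | (first_slice i <= l <= last_slice i)%N)
          xslice s j i l * slice_len l = duration i * xreq s i j].

Definition IP_feasible (s : solution) : Prop :=
  [/\ common_constraints s,
      forall i j, xreq s i j = 0 \/ xreq s i j = 1 &
      forall j i l, xslice s j i l = 0 \/ xslice s j i l = 1].

Definition LP_feasible (s : solution) : Prop :=
  [/\ common_constraints s,
      forall i j, 0 <= xreq s i j <= 1 &
      forall j i l, 0 <= xslice s j i l <= 1].

Definition IP_optimal (s : solution) : Prop :=
  IP_feasible s /\ forall s', IP_feasible s' -> weight s' <= weight s.

Definition LP_optimal (s : solution) : Prop :=
  LP_feasible s /\ forall s', LP_feasible s' -> weight s' <= weight s.

Definition alpha : R := expR 1 / (expR 1 - 1).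

Local Open Scope fset_scope.

(* A run of the allocation part of CATE, up to the final random draw: x is the
   optimal solution computed for the linear program, and (L, q) is the
   decomposition of x / alpha from which the output is drawn. For an integral
   feasible l, xtot l i is the 0-1 indicator that request i wins in l. *)
Record CATE_run (x : solution) (L : {fset solution}) (q : solution -> R) : Prop
  := CATERun {
  CATE_LP_optimal : LP_optimal x;
  CATE_IP_feasible : forall l, l \in L -> IP_feasible l;
  CATE_prob_ge0 : forall l, l \in L -> 0 <= q l;
  CATE_prob_sum1 : \sum_(l <- L) q l = 1;
  CATE_decomposition : forall i : 'I_n,
    \sum_(l <- L) xtot l i * q l = xtot x i / alpha
}.

Definition expected_weight (L : {fset solution}) (q : solution -> R) : R :=
  \sum_(l <- L) q l * weight l.

End Programs.

(* Main.v *)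
(** An integral solution is in particular a fractional one, so the optimum of
    LP(2) dominates that of IP(1). The weight of a solution depends linearly on
    the totals [xtot] only, and the expected totals of the output are those of
    the optimum of LP(2) divided by [alpha]; hence so is the expected weight. *)
Require Import Defs.
From mathcomp Require Import all_boot all_order all_algebra finmap.
From mathcomp Require Import reals sequences exp.

Import Order.TTheory GRing.Theory Num.Theory.
Local Open Scope ring_scope.

(** The decomposition constrains only the totals [xtot], not individual channels. *)
Lemma weight_xtot (R : realType) (m n : nat) (A : auction R m n)
    (s : solution A) :
  weight s = \sum_(i < n) request_weight A i * xtot s i.
Proof.
rewrite /weight exchange_big; apply: eq_bigr => i _.
by rewrite mulr_sumr.
Qed.

Lemma IP_feasible_LP (R : realType) (m n : nat) (A : auction R m n)
    (s : solution A) : IP_feasible s -> LP_feasible s.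
Proof.
case=> sC s01 t01; split=> // [i j | j i l].
  by case: (s01 i j) => ->; rewrite lexx ler01.
by case: (t01 j i l) => ->; rewrite lexx ler01.
Qed.

Lemma inv_alpha (R : realType) : (alpha : R)^-1 = 1 - 1 / expR 1.
Proof. by rewrite /alpha invf_div mulrBl divff// gt_eqF// expR_gt0. Qed.

Lemma inv_alpha_ge0 (R : realType) : 0 <= (alpha : R)^-1.
Proof. by rewrite invr_ge0 divr_ge0 ?expR_ge0// subr_ge0 ltW// expR_gt1. Qed.

(** This is an equality: the only slack in the final bound is the gap between the optima of LP(2)
    and IP(1). *)
Lemma expected_weight_CATE (R : realType) (m n : nat) (A : auction R m n)
    (x : solution A) (L : {fset solution A}) (q : solution A -> R) :
  CATE_run x L q -> expected_weight L q = alpha^-1 * weight x.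
Proof.
move=> run; rewrite /expected_weight weight_xtot mulr_sumr.
under eq_bigr => l _ do rewrite weight_xtot mulr_sumr.
rewrite exchange_big; apply: eq_bigr => i _ /=.
(* With the request fixed, [xtot x i / alpha] is isolated and expanded as an expectation over
   [L]. *)
rewrite mulrCA [_^-1 * _]mulrC -(CATE_decomposition run) mulr_sumr.
by apply: eq_bigr => l _; rewrite mulrCA [q l * _]mulrC.
Qed.

Theorem mainTheorem9 (R : realType) (m n : nat) (A : auction R m n)
    (x : solution A) (L : {fset solution A}) (q : solution A -> R)
    (opt : solution A) :
  CATE_run x L q -> IP_optimal opt ->
  (1 - 1 / expR 1) * weight opt <= expected_weight L q.
Proof.
move=> run [optF _]; rewrite (expected_weight_CATE _ _ _ _ _ _ _ run) -inv_alpha.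
apply: ler_wpM2l; first exact: inv_alpha_ge0.
by apply: (CATE_LP_optimal run).2; exact: IP_feasible_LP.
Qed.
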